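(* Let $0<q<1$, let $\star^L$ and $\star^R$ be the left, respectively right, $\mathcal{A}(\mathrm{SU}_q(2))$-linear Hodge operators on the exterior algebra of the $4D_+$ calculus associated with a nondegenerate hermitian and real contraction with parameters $\alpha,\nu,\gamma,\epsilon$ (see context). Then the Laplacian operators $\Box^L_{\mathrm{SU}_q(2)}x=-\star^L\mathrm{d}\star^L\mathrm{d}x$ and $\Box^R_{\mathrm{SU}_q(2)}x=-\star^R\mathrm{d}\star^R\mathrm{d}x$ on $\mathcal{A}(\mathrm{SU}_q(2))$ are given, for all $x\in\mathcal{A}(\mathrm{SU}_q(2))$, by $$\Box^L_{\mathrm{SU}_q(2)}x=\{\alpha(L_+L_-+q^2L_-L_+)+\nu L_0L_0+\gamma L_zL_z+2\epsilon L_0L_z\}\triangleright x,$$ $$\Box^R_{\mathrm{SU}_q(2)}x=\{\alpha(q^2R_+R_-+R_-R_+)+\nu R_0R_0+\gamma R_zR_z+2\epsilon R_0R_z\}\triangleright x .$$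
   Context: Fix $0<q<1$. $\mathcal{A}=\mathcal{A}(\mathrm{SU}_q(2))$ is the unital complex $*$-algebra generated by $a,c$ with relations $ac=qca$, $ac^*=qc^*a$, $cc^*=c^*c$, $a^*a+c^*c=1=aa^*+q^2cc^*$. $\mathcal{U}_q(\mathfrak{su}(2))$ is the Hopf algebra generated by $K^{\pm1},E,F$ with $K^{\pm1}E=q^{\pm1}EK^{\pm1}$, $K^{\pm1}F=q^{\mp1}FK^{\pm1}$, $[E,F]=\frac{K^2-K^{-2}}{q-q^{-1}}$ and $\Delta K^{\pm1}=K^{\pm1}\otimes K^{\pm1}$, $\Delta E=E\otimes K+K^{-1}\otimes E$, $\Delta F=F\otimes K+K^{-1}\otimes F$. It acts on the left on $\mathcal{A}$, with $h\triangleright(xy)=(h_{(1)}\triangleright x)(h_{(2)}\triangleright y)$, by $K\triangleright a=q^{-1/2}a$, $K\triangleright c=q^{-1/2}c$, $K\triangleright a^*=q^{1/2}a^*$, $K\triangleright c^*=q^{1/2}c^*$; $F\triangleright a=F\triangleright c=0$, $F\triangleright a^*=c$, $F\triangleright c^*=-q^{-1}a$; $E\triangleright a=-qc^*$, $E\triangleright c=a^*$, $E\triangleright a^*=E\triangleright c^*=0$. Let $L_-=q^{1/2}FK^{-1}$, $L_+=q^{-1/2}EK^{-1}$, $L_z=\frac{K^{-2}-1}{q-q^{-1}}$, $L_0=\frac{q(K^2-1)+q^{-1}(K^{-2}-1)}{(q-q^{-1})^2}+FE$, and $R_\pm=L_\pm K^2$, $R_z=L_zK^2$, $R_0=-L_0$.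 The $4D_+$ calculus: $\Omega^1(\mathrm{SU}_q(2))$ is the free left $\mathcal{A}$-module with basis $\omega_-,\omega_+,\omega_z,\omega_0$, $\mathrm{d}x=\sum_a(L_a\triangleright x)\omega_a$ (which also equals $\sum_a\omega_a(R_a\triangleright x)$), and right module structure $\omega_-x=x\omega_-+q^{-1/2}(KE\triangleright x)\omega_0$, $\omega_+x=x\omega_++q^{-1/2}(FK\triangleright x)\omega_0$, $\omega_0x=(K^2\triangleright x)\omega_0$, $\omega_zx=(q-q^{-1})q^{1/2}(FK^{-1}\triangleright x)\omega_-+(K^{-2}\triangleright x)\omega_z+(q-q^{-1})q^{-1/2}(EK^{-1}\triangleright x)\omega_++(q-q^{-1})\big(\big(FE+q^{-1}\tfrac{K^{-2}-K^2}{(q-q^{-1})^2}\big)\triangleright x\big)\omega_0$. The (Woronowicz) exterior algebra $\Omega(\mathrm{SU}_q(2))$ is generated by $\mathcal A$ and these 1-forms with the wedge relations $\omega_-\wedge\omega_-=\omega_+\wedge\omega_+=\omega_0\wedge\omega_0=0$; $\omega_z\wedge\omega_z=(q^2-q^{-2})\omega_+\wedge\omega_-$; $\omega_z\wedge\omega_\pm=-q^{\pm2}\omega_\pm\wedge\omega_z$; $\omega_\pm\wedge\omega_0=-\omega_0\wedge\omega_\pm$; $\omega_+\wedge\omega_-=-\omega_-\wedge\omega_+$; $\omega_z\wedge\omega_0+\omega_0\wedge\omega_z=(q-q^{-1})^2\omega_-\wedge\omega_+$. $\Omega^k$ is free as a left (and right) $\mathcal A$-module of rank $1,4,6,4,1$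 for $k=0,\dots,4$, with basis the wedge products of distinct generators (taken in a fixed order); $\mathrm{d}$ is extended as a graded derivation with $\mathrm{d}^2=0$. Hodge operators. A contraction map is a sesquilinear map (antilinear in the first entry) $\Gamma$ on the span of $\omega_-,\omega_+,\omega_z,\omega_0$. For the hermitian and real ones the only nonzero values are $\Gamma(\omega_-,\omega_-)=q^{-2}\Gamma(\omega_+,\omega_+)=\alpha$, $\Gamma(\omega_0,\omega_z)=\Gamma(\omega_z,\omega_0)=\epsilon$, $\Gamma(\omega_0,\omega_0)=\nu$, $\Gamma(\omega_z,\omega_z)=\gamma$, with real parameters satisfying $2\nu+(q^2-q^{-2})\epsilon=0$ and $2(\epsilon^2-\gamma\nu)+(q-q^{-1})^2(2q^2\alpha^2+\epsilon^2)=0$; nondegenerate means $\alpha\neq0$. Let $\mu=\mathrm{i}\,m\,\omega_-\wedge\omega_+\wedge\omega_0\wedge\omega_z$, $m\in\mathbb{R}$. On left invariant forms of degree 1 and 4 (the only degrees needed) the Hodge operator $\star$ of $\Gamma$ is $$\star\omega_-=\mathrm{i}m\,\alpha\,\omega_-\wedge\omega_0\wedge\omega_z,\qquad \star\omega_+=-\mathrm{i}m\,q^2\alpha\,\omega_+\wedge\omega_0\wedge\omega_z,$$ $$\star\omega_0=\mathrm{i}m(-\nu\,\omega_-\wedge\omega_+\wedge\omega_z+\epsilon\,\omega_-\wedge\omega_+\wedge\omega_0),\qquad \star\omega_z=\mathrm{i}m(-\epsilon\,\omega_-\wedge\omega_+\wedge\omega_z+\gamma\,\omega_-\wedge\omega_+\wedge\omega_0),$$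 and $m$ is normalized so that $\star\mu=1$. The operators on $\Omega(\mathrm{SU}_q(2))$ are $\star^L(x\omega)=x\star(\omega)$ and $\star^R(\omega x)=\star(\omega)x$ for $x\in\mathcal{A}$ and $\omega$ left invariant. *)

(* Defs.v *)
From HB Require Import structures.
From mathcomp Require Import all_boot all_order all_algebra.
From mathcomp Require Import complex reals.

Set Implicit Arguments.
Unset Strict Implicit.
Unset Printing Implicit Defensive.

Import Order.TTheory GRing.Theory Num.Theory.

Local Open Scope ring_scope.
Local Open Scope complex_scope.

Record star_involution (R : realType) (A : algType R[i]) (st : A -> A) : Prop := {
  star_antilinear : forall (k : R[i]) (x y : A),
    st (k *: x + y) = conjc k *: st x + st y;
  star_antimultiplicative : forall x y : A, st (x * y) = st y * st x;
  star_involutive : forall x : A, st (st x) = x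
}.

Record suq2_relations (R : realType) (q : R) (A : algType R[i]) (st : A -> A)
    (a c : A) : Prop := {
  suq2_ac : a * c = q%:C *: (c * a);
  suq2_acs : a * st c = q%:C *: (st c * a);
  suq2_ccs : c * st c = st c * c;
  suq2_det : st a * a + st c * c = 1;
  suq2_det' : a * st a + (q ^+ 2)%:C *: (c * st c) = 1
}.

(* The presentation is expressed by generation together with the existence of
   a *-homomorphism to any other solution of the relations; its uniqueness
   follows from generation. *)
Structure suq2 (R : realType) (q : R) := {
  suq2_alg :> algType R[i];
  suq2_star : suq2_alg -> suq2_alg;
  gen_a : suq2_alg;
  gen_c : suq2_alg;
  suq2_starP : star_involution suq2_star;
  suq2_rel : suq2_relations q suq2_star gen_a gen_c;
  suq2_generated : forall P : suq2_alg -> Prop,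
    P gen_a -> P gen_c -> P 1 ->
    (forall x, P x -> P (suq2_star x)) ->
    (forall (k : R[i]) x y, P x -> P y -> P (k *: x + y)) ->
    (forall x y, P x -> P y -> P (x * y)) ->
    forall x, P x;
  suq2_universal : forall (B : algType R[i]) (st : B -> B) (a' c' : B),
    star_involution st -> suq2_relations q st a' c' ->
    exists f : {lrmorphism suq2_alg -> B},
      [/\ f gen_a = a', f gen_c = c' & forall x, f (suq2_star x) = st (f x)]
}.

(* A finite sequence of pairs stands for the sum of the corresponding pure
   tensors in U (x) U; two such sequences denote the same tensor iff all
   bilinear maps agree on them. *)
Definition tensor_eq (R : realType) (U : algType R[i]) (s t : seq (U * U)) : Prop :=
  forall (V : lmodType R[i]) (b : {bilinear U -> U -> V}),
    \sum_(p <- s) b p.1 p.2 = \sum_(p <- t) b p.1 p.2.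

Record uqsu2_relations (R : realType) (q : R) (U : algType R[i])
    (K Ki E F : U) : Prop := {
  uq_KKi : K * Ki = 1;
  uq_KiK : Ki * K = 1;
  uq_KE : K * E = q%:C *: (E * K);
  uq_KiE : Ki * E = (q^-1)%:C *: (E * Ki);
  uq_KF : K * F = (q^-1)%:C *: (F * K);
  uq_KiF : Ki * F = q%:C *: (F * Ki);
  uq_EF : E * F - F * E = ((q - q^-1)^-1)%:C *: (K ^+ 2 - Ki ^+ 2)
}.

(* The counit and the antipode are determined by the coproduct. *)
Structure uqsu2 (R : realType) (q : R) := {
  uq_alg :> algType R[i];
  genK : uq_alg;
  genKi : uq_alg;
  genE : uq_alg;
  genF : uq_alg;
  uq_rel : uqsu2_relations q genK genKi genE genF;
  uq_generated : forall P : uq_alg -> Prop,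
    P genK -> P genKi -> P genE -> P genF -> P 1 ->
    (forall (k : R[i]) g h, P g -> P h -> P (k *: g + h)) ->
    (forall g h, P g -> P h -> P (g * h)) ->
    forall h, P h;
  uq_universal : forall (B : algType R[i]) (K Ki E F : B),
    uqsu2_relations q K Ki E F ->
    exists f : {lrmorphism uq_alg -> B},
      [/\ f genK = K, f genKi = Ki, f genE = E & f genF = F];
  coprod : uq_alg -> seq (uq_alg * uq_alg);
  coprod_linear : forall (k : R[i]) g h,
    tensor_eq (coprod (k *: g + h))
              ([seq (k *: p.1, p.2) | p <- coprod g] ++ coprod h);
  coprod1 : tensor_eq (coprod 1) [:: (1, 1)];
  coprodM : forall g h,
    tensor_eq (coprod (g * h))
              [seq (p.1 * r.1, p.2 * r.2) | p <- coprod g, r <- coprod h];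
  coprodK : tensor_eq (coprod genK) [:: (genK, genK)];
  coprodKi : tensor_eq (coprod genKi) [:: (genKi, genKi)];
  coprodE : tensor_eq (coprod genE) [:: (genE, genK); (genKi, genE)];
  coprodF : tensor_eq (coprod genF) [:: (genF, genK); (genKi, genF)]
}.

Structure suq2_action (R : realType) (q : R) (A : suq2 q) (U : uqsu2 q) := {
  act :> U -> A -> A;
  act_linearl : forall (k : R[i]) (g h : U) (x : A),
    act (k *: g + h) x = k *: act g x + act h x;
  act_linearr : forall (k : R[i]) (h : U) (x y : A),
    act h (k *: x + y) = k *: act h x + act h y;
  act1 : forall x : A, act 1 x = x;
  actM : forall (g h : U) (x : A), act (g * h) x = act g (act h x);
  act_mul : forall (h : U) (x y : A),
    act h (x * y) = \sum_(p <- coprod h) act p.1 x * act p.2 y;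
  actK_a : act (genK U) (gen_a A) = ((Num.sqrt q)^-1)%:C *: gen_a A;
  actK_c : act (genK U) (gen_c A) = ((Num.sqrt q)^-1)%:C *: gen_c A;
  actK_as : act (genK U) (suq2_star (gen_a A)) =
    (Num.sqrt q)%:C *: suq2_star (gen_a A);
  actK_cs : act (genK U) (suq2_star (gen_c A)) =
    (Num.sqrt q)%:C *: suq2_star (gen_c A);
  actF_a : act (genF U) (gen_a A) = 0;
  actF_c : act (genF U) (gen_c A) = 0;
  actF_as : act (genF U) (suq2_star (gen_a A)) = gen_c A;
  actF_cs : act (genF U) (suq2_star (gen_c A)) = - ((q^-1)%:C *: gen_a A);
  actE_a : act (genE U) (gen_a A) = - (q%:C *: suq2_star (gen_c A));
  actE_c : act (genE U) (gen_c A) = suq2_star (gen_a A);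
  actE_as : act (genE U) (suq2_star (gen_a A)) = 0;
  actE_cs : act (genE U) (suq2_star (gen_c A)) = 0
}.

Definition Lminus (R : realType) (q : R) (U : uqsu2 q) : U :=
  (Num.sqrt q)%:C *: (genF U * genKi U).

Definition Lplus (R : realType) (q : R) (U : uqsu2 q) : U :=
  ((Num.sqrt q)^-1)%:C *: (genE U * genKi U).

Definition Lz (R : realType) (q : R) (U : uqsu2 q) : U :=
  ((q - q^-1)^-1)%:C *: (genKi U ^+ 2 - 1).

Definition L0 (R : realType) (q : R) (U : uqsu2 q) : U :=
  ((q - q^-1) ^- 2)%:C *:
    (q%:C *: (genK U ^+ 2 - 1) + (q^-1)%:C *: (genKi U ^+ 2 - 1))
  + genF U * genE U.

Definition Rminus (R : realType) (q : R) (U : uqsu2 q) : U :=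
  Lminus U * genK U ^+ 2.

Definition Rplus (R : realType) (q : R) (U : uqsu2 q) : U :=
  Lplus U * genK U ^+ 2.

Definition Rz (R : realType) (q : R) (U : uqsu2 q) : U :=
  Lz U * genK U ^+ 2.

Definition R0 (R : realType) (q : R) (U : uqsu2 q) : U := - L0 U.

(* The product over ordinals is taken in increasing order, so that these are
   the ordered products of distinct entries of w. The order chosen below for
   the generators is omega_-, omega_+, omega_0, omega_z, as in the volume form. *)
Definition wedge_basis (O : nzRingType) (w : 4.-tuple O) (I : {set 'I_4}) : O :=
  \prod_(i < 4 | i \in I) tnth w i.

Definition form_of_degree (R : realType) (A O : algType R[i])
    (inc : A -> O) (w : 4.-tuple O) (k : nat) (eta : O) : Prop :=
  exists x : {ffun {set 'I_4} -> A},
    eta = \sum_(I : {set 'I_4} | #|I| == k) inc (x I) * wedge_basis w I.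

(* Freeness of all the A-modules Omega^k, on the left and on the right, is
   stated at once for their direct sum. *)
Structure calculus4Dp (R : realType) (q : R) (A : suq2 q) (U : uqsu2 q)
    (ac : suq2_action A U) := {
  ext_alg :> algType R[i];
  inc : {lrmorphism A -> ext_alg};
  wm : ext_alg;
  wp : ext_alg;
  w0 : ext_alg;
  wz : ext_alg;
  d : {linear ext_alg -> ext_alg};
  ext_left_free : forall eta : ext_alg,
    exists! x : {ffun {set 'I_4} -> A},
      eta = \sum_(I : {set 'I_4}) inc (x I) * wedge_basis [tuple wm; wp; w0; wz] I;
  ext_right_free : forall eta : ext_alg,
    exists! x : {ffun {set 'I_4} -> A},
      eta = \sum_(I : {set 'I_4}) wedge_basis [tuple wm; wp; w0; wz] I * inc (x I);
  wm_right : forall x : A,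
    wm * inc x = inc x * wm
      + ((Num.sqrt q)^-1)%:C *: (inc (ac (genK U * genE U) x) * w0);
  wp_right : forall x : A,
    wp * inc x = inc x * wp
      + ((Num.sqrt q)^-1)%:C *: (inc (ac (genF U * genK U) x) * w0);
  w0_right : forall x : A, w0 * inc x = inc (ac (genK U ^+ 2) x) * w0;
  wz_right : forall x : A,
    wz * inc x =
      ((q - q^-1) * Num.sqrt q)%:C *: (inc (ac (genF U * genKi U) x) * wm)
      + inc (ac (genKi U ^+ 2) x) * wz
      + ((q - q^-1) * (Num.sqrt q)^-1)%:C *: (inc (ac (genE U * genKi U) x) * wp)
      + (q - q^-1)%:C *:
          (inc (ac (genF U * genE U
                    + (q^-1 * (q - q^-1) ^- 2)%:C *: (genKi U ^+ 2 - genK U ^+ 2)) x)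
           * w0);
  wm_wm : wm * wm = 0;
  wp_wp : wp * wp = 0;
  w0_w0 : w0 * w0 = 0;
  wz_wz : wz * wz = (q ^+ 2 - q ^- 2)%:C *: (wp * wm);
  wz_wm : wz * wm = - ((q ^- 2)%:C *: (wm * wz));
  wz_wp : wz * wp = - ((q ^+ 2)%:C *: (wp * wz));
  wm_w0 : wm * w0 = - (w0 * wm);
  wp_w0 : wp * w0 = - (w0 * wp);
  wp_wm : wp * wm = - (wm * wp);
  wz_w0 : wz * w0 + w0 * wz = ((q - q^-1) ^+ 2)%:C *: (wm * wp);
  d_fun : forall x : A,
    d (inc x) = inc (ac (Lminus U) x) * wm + inc (ac (Lplus U) x) * wp
                + inc (ac (L0 U) x) * w0 + inc (ac (Lz U) x) * wz;
  d_degree : forall (k : nat) (eta : ext_alg),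
    form_of_degree inc [tuple wm; wp; w0; wz] k eta ->
    form_of_degree inc [tuple wm; wp; w0; wz] k.+1 (d eta);
  d_leibniz : forall (k : nat) (eta zeta : ext_alg),
    form_of_degree inc [tuple wm; wp; w0; wz] k eta ->
    d (eta * zeta) = d eta * zeta + (-1) ^+ k *: (eta * d zeta);
  d_d : forall eta : ext_alg, d (d eta) = 0
}.

Arguments inc {R q A U ac} c.
Arguments wm {R q A U ac} c.
Arguments wp {R q A U ac} c.
Arguments w0 {R q A U ac} c.
Arguments wz {R q A U ac} c.
Arguments d {R q A U ac} c.

Definition left_invariant (R : realType) (q : R) (A : suq2 q) (U : uqsu2 q)
    (ac : suq2_action A U) (O : calculus4Dp ac) (eta : O) : Prop :=
  exists k : {ffun {set 'I_4} -> R[i]},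
    eta = \sum_(I : {set 'I_4})
            k I *: wedge_basis [tuple wm O; wp O; w0 O; wz O] I.

Definition left_invariant1 (R : realType) (q : R) (A : suq2 q) (U : uqsu2 q)
    (ac : suq2_action A U) (O : calculus4Dp ac) (eta : O) : Prop :=
  exists k : {ffun 'I_4 -> R[i]},
    eta = \sum_(i < 4) k i *: tnth [tuple wm O; wp O; w0 O; wz O] i.

(* Only the values of G on left invariant one-forms are relevant. *)
Record contraction (R : realType) (q : R) (A : suq2 q) (U : uqsu2 q)
    (ac : suq2_action A U) (O : calculus4Dp ac) (G : O -> O -> R[i]) : Prop := {
  contraction_antilinearl : forall (k : R[i]) (eta zeta theta : O),
    left_invariant1 eta -> left_invariant1 zeta -> left_invariant1 theta ->
    G (k *: eta + zeta) theta = conjc k * G eta theta + G zeta theta;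
  contraction_linearr : forall (k : R[i]) (eta zeta theta : O),
    left_invariant1 eta -> left_invariant1 zeta -> left_invariant1 theta ->
    G theta (k *: eta + zeta) = k * G theta eta + G theta zeta
}.

(* The hermitian and real contractions, through their explicit parametrization. *)
Record hermitian_real_contraction (R : realType) (q : R) (A : suq2 q)
    (U : uqsu2 q) (ac : suq2_action A U) (O : calculus4Dp ac)
    (G : O -> O -> R[i]) (alpha nu gamma epsilon : R) : Prop := {
  hrc_contraction : contraction G;
  hrc_mm : G (wm O) (wm O) = alpha%:C;
  hrc_pp : (q ^- 2)%:C * G (wp O) (wp O) = alpha%:C;
  hrc_0z : G (w0 O) (wz O) = epsilon%:C;
  hrc_z0 : G (wz O) (w0 O) = epsilon%:C;
  hrc_00 : G (w0 O) (w0 O) = nu%:C;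
  hrc_zz : G (wz O) (wz O) = gamma%:C;
  hrc_mp : G (wm O) (wp O) = 0;
  hrc_m0 : G (wm O) (w0 O) = 0;
  hrc_mz : G (wm O) (wz O) = 0;
  hrc_pm : G (wp O) (wm O) = 0;
  hrc_p0 : G (wp O) (w0 O) = 0;
  hrc_pz : G (wp O) (wz O) = 0;
  hrc_0m : G (w0 O) (wm O) = 0;
  hrc_0p : G (w0 O) (wp O) = 0;
  hrc_zm : G (wz O) (wm O) = 0;
  hrc_zp : G (wz O) (wp O) = 0;
  hrc_eq1 : 2 * nu + (q ^+ 2 - q ^- 2) * epsilon = 0;
  hrc_eq2 : 2 * (epsilon ^+ 2 - gamma * nu)
    + (q - q^-1) ^+ 2 * (2 * q ^+ 2 * alpha ^+ 2 + epsilon ^+ 2) = 0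
}.

Definition volume (R : realType) (q : R) (A : suq2 q) (U : uqsu2 q)
    (ac : suq2_action A U) (O : calculus4Dp ac) (m : R) : O :=
  ('i * m%:C) *: (wm O * wp O * w0 O * wz O).

(* Only the values of star on left invariant forms are relevant, and among
   these only those in degrees 1 and 4 are prescribed. The last field is the
   normalization of m (in particular it forces m to be nonzero). *)
Record hodge (R : realType) (q : R) (A : suq2 q) (U : uqsu2 q)
    (ac : suq2_action A U) (O : calculus4Dp ac)
    (alpha nu gamma epsilon m : R) (star : O -> O) : Prop := {
  hodge_linear : forall (k : R[i]) (eta zeta : O),
    left_invariant eta -> left_invariant zeta ->
    star (k *: eta + zeta) = k *: star eta + star zeta;
  hodge_m : star (wm O) = ('i * m%:C * alpha%:C) *: (wm O * w0 O * wz O);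
  hodge_p : star (wp O) =
    - (('i * m%:C * (q ^+ 2)%:C * alpha%:C) *: (wp O * w0 O * wz O));
  hodge_0 : star (w0 O) =
    ('i * m%:C) *: (- (nu%:C *: (wm O * wp O * wz O))
                    + epsilon%:C *: (wm O * wp O * w0 O));
  hodge_z : star (wz O) =
    ('i * m%:C) *: (- (epsilon%:C *: (wm O * wp O * wz O))
                    + gamma%:C *: (wm O * wp O * w0 O));
  hodge_volume : star (volume O m) = 1
}.

Record left_hodge (R : realType) (q : R) (A : suq2 q) (U : uqsu2 q)
    (ac : suq2_action A U) (O : calculus4Dp ac) (star starL : O -> O) : Prop := {
  starL_additive : forall eta zeta : O, starL (eta + zeta) = starL eta + starL zeta;
  starL_left : forall (x : A) (eta : O),
    left_invariant eta -> starL (inc O x * eta) = inc O x * star eta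
}.

Record right_hodge (R : realType) (q : R) (A : suq2 q) (U : uqsu2 q)
    (ac : suq2_action A U) (O : calculus4Dp ac) (star starR : O -> O) : Prop := {
  starR_additive : forall eta zeta : O, starR (eta + zeta) = starR eta + starR zeta;
  starR_right : forall (x : A) (eta : O),
    left_invariant eta -> starR (eta * inc O x) = star eta * inc O x
}.

(* st is star^L or star^R; the value is a form of degree 0, i.e. lies in the
   image of the embedding inc of A. *)
Definition laplacian (R : realType) (q : R) (A : suq2 q) (U : uqsu2 q)
    (ac : suq2_action A U) (O : calculus4Dp ac) (st : O -> O) (x : A) : O :=
  - st (d O (st (d O (inc O x)))).

(* Main.v *)
Require Import Defs.
From mathcomp Require Import all_boot all_order all_algebra.
From mathcomp Require Import complex reals ring.

Set Implicit Arguments.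
Unset Strict Implicit.
Unset Printing Implicit Defensive.

Import Order.TTheory GRing.Theory Num.Theory.

Local Open Scope ring_scope.
Local Open Scope complex_scope.

(** The calculus is inner. With [lam = q - q^-1], the left invariant one-form
[theta = lam^-1 (wz + (q + q^-1) / lam w0)] satisfies [d x = theta x - x theta]
for every function [x] (lemma [d_inc]), and the wedge relations give
[theta theta = 0] ([theta_theta]). These two facts imply that [d] is the
anticommutator with [theta] on every one-form [x dy] ([d_odd_inc]), and each of
the four generators is a combination of such forms, by explicit formulas in
[a], [c] and their adjoints ([wp_exact], [wm_exact], [wz_w0_exact1],
[wz_w0_exact2]). By the Leibniz rule, [d] is then the anticommutator with [theta]
on products of three generators. The product tables of three-forms with
generators show that this anticommutator vanishes on the four products which
occur in the Hodge duals of the generators ([theta_three]): these duals are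
closed.

Consequently, for [y] a function and [eta] the Hodge dual of a generator,
[d (y eta) = dy eta] and [d (eta y) = - eta dy], and both sides expand through
[dy = sum (L_a y) w_a = sum w_a (R_a y)] into multiples of the volume form: by the
product tables, the product of the Hodge dual of a generator with a generator is,
up to sign, zero or one of [alpha], [q^2 alpha], [nu], [gamma], [epsilon] times the
volume form. This gives the two quadratic expressions; the terms with [L0 Lz] and
[Lz L0] are gathered into one because [L0] commutes with [Lz] ([comm_L0_Lz]), and
likewise on the right. The right form of [dx] follows ([d_inc_right]) from the
bimodule relations and identities between the operators [L] and [R]
([Lminus_Rminus], [Lplus_Rplus], [Lz_Rz], [L0_R]). *)

(** * Linear identities in a module *)

Section LinearCombinations.
Variables (K : comNzRingType) (V : lmodType K).

(** Formal linear combinations of vectors referred to by their position in a list;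
two of them have the same value as soon as their coefficients agree, which leaves
scalar identities for [ring] or [field]. *)
Inductive lin_expr :=
  | LinAtom of nat | Lin0 | LinN of lin_expr
  | LinD of lin_expr & lin_expr | LinZ of K & lin_expr.

Fixpoint lin_val (v : seq V) (e : lin_expr) : V :=
  match e with
  | LinAtom j => v`_j
  | Lin0 => 0
  | LinN e1 => - lin_val v e1
  | LinD e1 e2 => lin_val v e1 + lin_val v e2
  | LinZ k e1 => k *: lin_val v e1
  end.

Fixpoint lin_coef (i : nat) (e : lin_expr) : K :=
  match e with
  | LinAtom j => if i == j then 1 else 0
  | Lin0 => 0
  | LinN e1 => - lin_coef i e1
  | LinD e1 e2 => lin_coef i e1 + lin_coef i e2
  | LinZ k e1 => k * lin_coef i e1
  end.

Lemma lin_valE v e : lin_val v e = \sum_(i < size v) lin_coef i e *: v`_i.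
Proof.
elim: e => [j||e1 IH1|e1 IH1 e2 IH2|k e1 IH1] /=.
- have [jv|vj] := ltnP j (size v); last first.
    rewrite nth_default // big1 // => i _.
    by rewrite ltn_eqF ?scale0r // (leq_trans (ltn_ord i)).
  rewrite (bigD1 (Ordinal jv)) //= eqxx scale1r big1 ?addr0 // => i /negPf.
  by rewrite -val_eqE /= => ->; rewrite scale0r.
- by rewrite big1 // => i _; rewrite scale0r.
- by rewrite IH1 -sumrN; apply: eq_bigr => i _; rewrite scaleNr.
- by rewrite IH1 IH2 -big_split; apply: eq_bigr => i _; rewrite scalerDl.
- by rewrite IH1 scaler_sumr; apply: eq_bigr => i _; rewrite scalerA.
Qed.

Fixpoint lin_coefs_eq (n : nat) (e1 e2 : lin_expr) : Prop :=
  if n is n'.+1 then lin_coef n' e1 = lin_coef n' e2 /\ lin_coefs_eq n' e1 e2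
  else True.

Lemma lin_val_eq v e1 e2 :
  lin_coefs_eq (size v) e1 e2 -> lin_val v e1 = lin_val v e2.
Proof.
move=> ee; rewrite !lin_valE; apply: eq_bigr => -[i /= iv] _; congr (_ *: _).
elim: (size v) iv ee => //= n IHn; rewrite ltnS leq_eqVlt.
by move=> /predU1P[-> []|lt_in [_ /(IHn lt_in)]].
Qed.

End LinearCombinations.

Arguments LinAtom {K}.
Arguments Lin0 {K}.

(* Vectors are compared up to unification, because one product may be typed
   through different instances of the algebra structure. *)
Ltac lin_mem x l :=
  lazymatch l with
  | ?y :: ?l' =>
      match constr:(tt) with
      | _ => let _ := match constr:(tt) with _ => unify x y end in constr:(true)
      | _ => lin_mem x l'
      end
  | [::] => constr:(false)
  end.

Ltac lin_atoms e l :=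
  lazymatch e with
  | (?a + ?b)%R => let l' := lin_atoms a l in lin_atoms b l'
  | (- ?a)%R => lin_atoms a l
  | (_ *: ?a)%R => lin_atoms a l
  | (0)%R => l
  | _ => lazymatch lin_mem e l with
         | true => l
         | false => constr:(e :: l)
         end
  end.

Ltac lin_index x l :=
  lazymatch l with
  | ?y :: ?l' =>
      match constr:(tt) with
      | _ => let _ := match constr:(tt) with _ => unify x y end in constr:(0%N)
      | _ => let n := lin_index x l' in constr:(n.+1)
      end
  end.

Ltac lin_quote K e l :=
  lazymatch e with
  | (?a + ?b)%R =>
      let a' := lin_quote K a l in let b' := lin_quote K b l in constr:(LinD a' b')
  | (- ?a)%R => let a' := lin_quote K a l in constr:(LinN a')
  | (?k *: ?a)%R => let a' := lin_quote K a l in constr:(LinZ k a')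
  | (0)%R => constr:(@Lin0 K)
  | _ => let n := lin_index e l in constr:(@LinAtom K n)
  end.

(** Reduces an equality in a [K]-module, seen as an equality of linear combinations
of its non-linear subterms, to one scalar equality for each of these subterms. *)
Ltac lin_comb K :=
  lazymatch goal with
  | |- @eq ?V ?e1 ?e2 =>
      let l1 := lin_atoms e1 (@nil V) in
      let l := lin_atoms e2 l1 in
      let f1 := lin_quote K e1 l in
      let f2 := lin_quote K e2 l in
      change (lin_val l f1 = lin_val l f2);
      apply: lin_val_eq; rewrite /=; do ?[split=> //]
  end.

(** * Operators of the quantum enveloping algebra *)

Section Scalars.
Variables (R : realType) (q : R).
Hypotheses (q_gt0 : 0 < q) (q_lt1 : q < 1).

Lemma qC_neq0 : q%:C != 0 :> R[i].
Proof. by rewrite fmorph_eq0 gt_eqF. Qed.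

Lemma qC2_sub1_neq0 : q%:C * q%:C - 1 != 0 :> R[i].
Proof.
rewrite -rmorphM -(rmorph1 (real_complex R)) -rmorphB fmorph_eq0 subr_eq0.
by rewrite lt_eqF // mulr_ilt1 // ltW.
Qed.

Lemma sqrtC_neq0 : (Num.sqrt q)%:C != 0 :> R[i].
Proof. by rewrite fmorph_eq0 gt_eqF // sqrtr_gt0. Qed.

End Scalars.

Lemma comm_scale (K : comNzRingType) (U : algType K) (k : K) (u v : U) :
  GRing.comm u v -> GRing.comm u (k *: v).
Proof. by rewrite /GRing.comm -scalerAl -scalerAr => ->. Qed.

Section Uq.
Variables (R : realType) (q : R).
Hypotheses (q_gt0 : 0 < q) (q_lt1 : q < 1).
Let q0 := qC_neq0 q_gt0.
Let q1 := qC2_sub1_neq0 q_gt0 q_lt1.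
Let t0 := sqrtC_neq0 q_gt0.
Variable U : uqsu2 q.

Local Notation K := (genK U).
Local Notation Ki := (genKi U).
Local Notation E := (genE U).
Local Notation F := (genF U).
Local Notation t := (Num.sqrt q).
Local Notation lam := (q - q^-1).

Let rel := uq_rel U.

Lemma comm_K_Ki : GRing.comm K Ki.
Proof. by rewrite /GRing.comm (uq_KKi rel) (uq_KiK rel). Qed.

(** The powers of [q] produced by [F] and by [E] cancel. *)
Lemma comm_K_FE : GRing.comm K (F * E).
Proof.
rewrite /GRing.comm mulrA (uq_KF rel) -scalerAl -[F * K * E]mulrA (uq_KE rel) -scalerAr.
by rewrite scalerA mulrA -rmorphM mulVf ?gt_eqF // scale1r.
Qed.

Lemma comm_Ki_FE : GRing.comm Ki (F * E).
Proof.
rewrite /GRing.comm mulrA (uq_KiF rel) -scalerAl -[F * Ki * E]mulrA (uq_KiE rel) -scalerAr.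
by rewrite scalerA mulrA -rmorphM mulfV ?gt_eqF // scale1r.
Qed.

Lemma KiX2_KX2 : Ki ^+ 2 * K ^+ 2 = 1.
Proof. by rewrite !expr2 -mulrA [Ki * (K * K)]mulrA (uq_KiK rel) mul1r (uq_KiK rel). Qed.

Lemma KX2_KiX2 : K ^+ 2 * Ki ^+ 2 = 1.
Proof. by rewrite !expr2 -mulrA [K * (Ki * Ki)]mulrA (uq_KKi rel) mul1r (uq_KKi rel). Qed.

Lemma Ki_KX2 : Ki * K ^+ 2 = K.
Proof. by rewrite expr2 mulrA (uq_KiK rel) mul1r. Qed.

Lemma RminusE : Rminus U = t%:C *: (F * K).
Proof. by rewrite /Rminus /Lminus -scalerAl -mulrA Ki_KX2. Qed.

Lemma RplusE : Rplus U = (t^-1)%:C *: (E * K).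
Proof. by rewrite /Rplus /Lplus -scalerAl -mulrA Ki_KX2. Qed.

Lemma RzE : Rz U = (lam^-1)%:C *: (1 - K ^+ 2).
Proof. by rewrite /Rz /Lz -scalerAl mulrBl KiX2_KX2 mul1r. Qed.

Lemma comm_L0 (u : U) :
  GRing.comm u K -> GRing.comm u Ki -> GRing.comm u (F * E) -> GRing.comm u (L0 U).
Proof.
move=> uK uKi uFE; have uB1 v : GRing.comm u v -> GRing.comm u (v ^+ 2 - 1).
  by move=> uv; apply: commrB; [apply: commrX | apply: commr1].
by apply: commrD => //; apply: comm_scale; apply: commrD; apply: comm_scale; apply: uB1.
Qed.

Lemma comm_K_L0 : GRing.comm K (L0 U).
Proof. by apply: comm_L0; [|exact: comm_K_Ki|exact: comm_K_FE]. Qed.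

Lemma comm_L0_Lz : GRing.comm (L0 U) (Lz U).
Proof.
apply: comm_scale; apply: commrB; last exact: commr1.
apply: commrX; apply: commr_sym; apply: comm_L0 => //; last exact: comm_Ki_FE.
exact/commr_sym/comm_K_Ki.
Qed.

Lemma comm_R0_Rz : GRing.comm (R0 U) (Rz U).
Proof.
apply: commr_sym; apply: commrN; apply: commr_sym; apply: commrM.
  exact: comm_L0_Lz.
exact/commrX/commr_sym/comm_K_L0.
Qed.

(** The coefficient of [w0] in [theta x - x theta]: the second summand is the
contribution of the [w0] component of [theta]. *)
Lemma theta_L0 :
  lam%:C *: (F * E + (q^-1 * lam ^- 2)%:C *: (Ki ^+ 2 - K ^+ 2))
    + ((q + q^-1) / lam)%:C *: (K ^+ 2 - 1) = lam%:C *: L0 U.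
Proof. by rewrite /L0; lin_comb R[i]; field; rewrite ?q0 ?q1. Qed.

(** With [Lplus_Rplus], [Lz_Rz] and [L0_R], this compares coefficients in
[sum_a (L_a x) w_a = sum_a w_a (R_a x)], once the generators on the right-hand side
have been moved to the right of the functions. *)
Lemma Lminus_Rminus :
  Rminus U + (lam * t)%:C *: (F * Ki * Rz U) = Lminus U.
Proof.
rewrite RminusE RzE /Lminus -!scalerAr mulrBr mulr1 -mulrA Ki_KX2.
by lin_comb R[i]; field; rewrite ?q0 ?q1.
Qed.

Lemma Lplus_Rplus :
  Rplus U + (lam * t^-1)%:C *: (E * Ki * Rz U) = Lplus U.
Proof.
rewrite RplusE RzE /Lplus -!scalerAr mulrBr mulr1 -mulrA Ki_KX2.
by lin_comb R[i]; field; rewrite ?q0 ?q1 ?t0.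
Qed.

Lemma Lz_Rz : Ki ^+ 2 * Rz U = Lz U.
Proof. by rewrite RzE -scalerAr mulrBr mulr1 KiX2_KX2. Qed.

Lemma EF_KX2 : E * F * K ^+ 2 = F * E * K ^+ 2 + (lam^-1)%:C *: (K ^+ 4 - 1).
Proof.
move: (uq_EF rel) => /(congr1 (fun u => u * K ^+ 2)).
rewrite mulrBl -scalerAl mulrBl -exprD KiX2_KX2 => <-.
by rewrite addrC subrK.
Qed.

Lemma KE_Rminus : (t^-1)%:C *: (K * E * Rminus U) = E * F * K ^+ 2.
Proof.
rewrite RminusE (uq_KE rel) -!(scalerAl, scalerAr) -[E * K * _]mulrA [K * (F * K)]mulrA.
rewrite (uq_KF rel) -!(scalerAl, scalerAr) !scalerA expr2 !mulrA -[RHS]scale1r.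
by congr (_ *: _); field; rewrite q0 t0.
Qed.

Lemma FK_Rplus : (t^-1)%:C *: (F * K * Rplus U) = F * E * K ^+ 2.
Proof.
rewrite RplusE -scalerAr -[F * K * _]mulrA [K * (E * K)]mulrA (uq_KE rel) -scalerAl -scalerAr.
rewrite !scalerA expr2 !mulrA -[RHS]scale1r; congr (_ *: _).
have -> : q%:C = t%:C * t%:C by rewrite -rmorphM -expr2 sqr_sqrtr // ltW.
by field.
Qed.

Lemma L0_R : (t^-1)%:C *: (K * E * Rminus U) + (t^-1)%:C *: (F * K * Rplus U)
   + lam%:C *: ((F * E + (q^-1 * lam ^- 2)%:C *: (Ki ^+ 2 - K ^+ 2)) * Rz U)
   + K ^+ 2 * R0 U = L0 U.
Proof.
rewrite KE_Rminus FK_Rplus EF_KX2 RzE /R0 /L0.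
(* Everything is now a combination of words in K^2, K^-2 and FE, which commute. *)
rewrite !(mulrDl, mulrDr, mulrN, mulNr, mulr1, mul1r, =^~ scalerAr, =^~ scalerAl).
rewrite KiX2_KX2 KX2_KiX2 (commrX 2 (commr_sym comm_K_FE)) -!exprD.
by lin_comb R[i]; field; rewrite ?q0 ?q1.
Qed.

End Uq.

(** * Wedge products of the generators *)

Section Wedge.
Variables (R : realType) (q : R).
Hypotheses (q_gt0 : 0 < q) (q_lt1 : q < 1).
Let q0 := qC_neq0 q_gt0.
Let q1 := qC2_sub1_neq0 q_gt0 q_lt1.
Variables (A : suq2 q) (U : uqsu2 q) (ac : suq2_action A U) (O : calculus4Dp ac).

Local Notation wm := (wm O).
Local Notation wp := (wp O).
Local Notation w0 := (w0 O).
Local Notation wz := (wz O).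
Local Notation lam := (q - q^-1).

Lemma wz_w0_swap : wz * w0 = - (w0 * wz) + (lam ^+ 2)%:C *: (wm * wp).
Proof. by rewrite -(wz_w0 O) addrC -addrA subrr addr0. Qed.

(** The wedge relations oriented towards the order [wm], [wp], [w0], [wz]. *)
Lemma wedge_order :
  (((wm * wm = 0)%R * (wp * wp = 0)%R * (w0 * w0 = 0)%R)
  * ((wp * wm = - (wm * wp))%R * (w0 * wm = - (wm * w0))%R * (w0 * wp = - (wp * w0))%R)
  * ((wz * wm = - ((q ^- 2)%:C *: (wm * wz)))%R
     * (wz * wp = - ((q ^+ 2)%:C *: (wp * wz)))%R
     * (wz * w0 = - (w0 * wz) + (lam ^+ 2)%:C *: (wm * wp))%R
     * (wz * wz = - ((q ^+ 2 - q ^- 2)%:C *: (wm * wp)))%R))%type.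
Proof.
by do !split; rewrite ?wm_wm ?wp_wp ?w0_w0 ?wp_wm ?wm_w0 ?wp_w0 ?opprK
  ?wz_wm ?wz_wp ?wz_w0_swap ?wz_wz ?wp_wm ?scalerN.
Qed.

Lemma wedge_order_tail (x : O) :
  (((wm * (wm * x) = 0)%R * (wp * (wp * x) = 0)%R * (w0 * (w0 * x) = 0)%R)
  * ((wp * (wm * x) = - (wm * (wp * x)))%R * (w0 * (wm * x) = - (wm * (w0 * x)))%R
     * (w0 * (wp * x) = - (wp * (w0 * x)))%R)
  * ((wz * (wm * x) = - ((q ^- 2)%:C *: (wm * (wz * x))))%R
     * (wz * (wp * x) = - ((q ^+ 2)%:C *: (wp * (wz * x))))%R
     * (wz * (w0 * x) = - (w0 * (wz * x)) + (lam ^+ 2)%:C *: (wm * (wp * x)))%R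
     * (wz * (wz * x) = - ((q ^+ 2 - q ^- 2)%:C *: (wm * (wp * x))))%R))%type.
Proof.
by do !split; rewrite mulrA wedge_order ?mul0r // ?mulrDl ?mulNr -?scalerAl -?mulrA.
Qed.

Definition wedgeE := (mulrN, mulNr, mulr0, mul0r, mulrDr, mulrDl,
  fun k (x y : O) => esym (scalerAr k x y), fun k (x y : O) => esym (scalerAl k x y),
  wedge_order, wedge_order_tail).

Ltac wedge := rewrite -?mulrA ?wedgeE; lin_comb R[i]; field; rewrite ?q0 //.

Local Notation vol := (wm * wp * w0 * wz).

(** Products of the generators with the three-forms that span the Hodge duals: on the
left in these four lemmas, on the right in the next four. *)
Lemma wedge_left_m :
  ((wm * (wm * w0 * wz) = 0)%R * (wp * (wm * w0 * wz) = - vol)%R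
   * (w0 * (wm * w0 * wz) = 0)%R * (wz * (wm * w0 * wz) = 0)%R)%type.
Proof. do !split; wedge. Qed.

Lemma wedge_left_p :
  ((wm * (wp * w0 * wz) = vol)%R * (wp * (wp * w0 * wz) = 0)%R
   * (w0 * (wp * w0 * wz) = 0)%R * (wz * (wp * w0 * wz) = 0)%R)%type.
Proof. do !split; wedge. Qed.

Lemma wedge_left_0 :
  ((wm * (wm * wp * w0) = 0)%R * (wp * (wm * wp * w0) = 0)%R
   * (w0 * (wm * wp * w0) = 0)%R * (wz * (wm * wp * w0) = - vol)%R)%type.
Proof. do !split; wedge. Qed.

Lemma wedge_left_z :
  ((wm * (wm * wp * wz) = 0)%R * (wp * (wm * wp * wz) = 0)%R
   * (w0 * (wm * wp * wz) = vol)%R * (wz * (wm * wp * wz) = 0)%R)%type.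
Proof. do !split; wedge. Qed.

Lemma wedge_right_m :
  ((wm * w0 * wz * wm = 0)%R * (wm * w0 * wz * wp = (q ^+ 2)%:C *: vol)%R
   * (wm * w0 * wz * w0 = 0)%R * (wm * w0 * wz * wz = 0)%R)%type.
Proof. do !split; wedge. Qed.

Lemma wedge_right_p :
  ((wp * w0 * wz * wm = - ((q ^- 2)%:C *: vol))%R * (wp * w0 * wz * wp = 0)%R
   * (wp * w0 * wz * w0 = 0)%R * (wp * w0 * wz * wz = 0)%R)%type.
Proof. do !split; wedge. Qed.

Lemma wedge_right_0 :
  ((wm * wp * w0 * wm = 0)%R * (wm * wp * w0 * wp = 0)%R
   * (wm * wp * w0 * w0 = 0)%R * (wm * wp * w0 * wz = vol)%R)%type.
Proof. do !split; wedge. Qed.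

Lemma wedge_right_z :
  ((wm * wp * wz * wm = 0)%R * (wm * wp * wz * wp = 0)%R
   * (wm * wp * wz * w0 = - vol)%R * (wm * wp * wz * wz = 0)%R)%type.
Proof. do !split; wedge. Qed.

(** The one-form whose commutator is [d] on functions. *)
Definition theta : O := (lam^-1)%:C *: (wz + ((q + q^-1) / lam)%:C *: w0).

(** The square of [wz] cancels against the anticommutator of [wz] and [w0]. *)
Lemma theta_theta : theta * theta = 0.
Proof.
rewrite /theta !wedgeE.
by lin_comb R[i]; field; rewrite ?q0 ?q1.
Qed.

End Wedge.

(** * Linearity of the action *)

Section Action.
Variables (R : realType) (q : R) (A : suq2 q) (U : uqsu2 q) (ac : suq2_action A U).

Lemma act0l x : ac 0 x = 0.
Proof.
by apply: (@addrI _ (ac 0 x)); rewrite addr0 -{1}(scale1r (ac 0 x)) -act_linearl scale1r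
  addr0.
Qed.

Lemma act0r h : ac h 0 = 0.
Proof.
by apply: (@addrI _ (ac h 0)); rewrite addr0 -{1}(scale1r (ac h 0)) -act_linearr scale1r
  addr0.
Qed.

Lemma actZl (k : R[i]) h x : ac (k *: h) x = k *: ac h x.
Proof. by rewrite -[k *: h]addr0 act_linearl act0l addr0. Qed.

Lemma actDl g h x : ac (g + h) x = ac g x + ac h x.
Proof. by rewrite -[g]scale1r act_linearl !scale1r. Qed.

Lemma actNl h x : ac (- h) x = - ac h x.
Proof. by rewrite -scaleN1r actZl scaleN1r. Qed.

Lemma actZr (k : R[i]) h x : ac h (k *: x) = k *: ac h x.
Proof. by rewrite -[k *: x]addr0 act_linearr act0r addr0. Qed.

Lemma actNr h x : ac h (- x) = - ac h x.
Proof. by rewrite -scaleN1r actZr scaleN1r. Qed.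

End Action.

(** * The differential is inner *)

Section Differential.
Variables (R : realType) (q : R).
Hypotheses (q_gt0 : 0 < q) (q_lt1 : q < 1).
Let q0 := qC_neq0 q_gt0.
Let q1 := qC2_sub1_neq0 q_gt0 q_lt1.
Let t0 := sqrtC_neq0 q_gt0.
Variables (A : suq2 q) (U : uqsu2 q) (ac : suq2_action A U) (O : calculus4Dp ac).

Local Notation wm := (wm O).
Local Notation wp := (wp O).
Local Notation w0 := (w0 O).
Local Notation wz := (wz O).
Local Notation lam := (q - q^-1).
Local Notation t := (Num.sqrt q).
Local Notation K := (genK U).
Local Notation Ki := (genKi U).
Local Notation E := (genE U).
Local Notation F := (genF U).
Local Notation theta := (theta O).

Lemma incD x y : inc O (x + y) = inc O x + inc O y.
Proof. exact: linearD. Qed.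

Lemma incN x : inc O (- x) = - inc O x.
Proof. exact: linearN. Qed.

Lemma incZ k x : inc O (k *: x) = k *: inc O x.
Proof. exact: linearZ. Qed.

Lemma incM x y : inc O (x * y) = inc O x * inc O y.
Proof. exact: rmorphM. Qed.

Lemma inc1 : inc O 1 = 1.
Proof. exact: rmorph1. Qed.

Lemma algZl (k : R[i]) (x y : O) : (k *: x) * y = k *: (x * y).
Proof. by rewrite scalerAl. Qed.

Lemma algZr (k : R[i]) (x y : O) : x * (k *: y) = k *: (x * y).
Proof. by rewrite scalerAr. Qed.

Definition pushE := (actZl, actDl, actNl, act1, incZ, incD, incN, mulrDl, mulrDr, mulNr, mulrN,
  algZl, algZr).

(** The commutator of [x] with [wz] already has the coefficients [L_a x] up to the
factor [lam], except for that of [w0], which the second component of [theta] corrects. *)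
Lemma d_inc x : d O (inc O x) = theta * inc O x - inc O x * theta.
Proof.
rewrite d_fun.
have -> : L0 U = (lam^-1)%:C *:
    (lam%:C *: (F * E + (q^-1 * lam ^- 2)%:C *: (Ki ^+ 2 - K ^+ 2))
     + ((q + q^-1) / lam)%:C *: (K ^+ 2 - 1)).
  rewrite theta_L0 // scalerA -[LHS]scale1r; congr (_ *: _).
  by field; rewrite ?q0 ?q1.
rewrite /theta /Lminus /Lplus /Lz !pushE.
rewrite wz_right w0_right !pushE.
by lin_comb R[i]; field; rewrite ?q0 ?q1.
Qed.

Lemma d_inc_right x : d O (inc O x) =
  wm * inc O (ac (Rminus U) x) + wp * inc O (ac (Rplus U) x)
  + w0 * inc O (ac (R0 U) x) + wz * inc O (ac (Rz U) x).
Proof.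
rewrite d_fun wm_right wp_right w0_right wz_right.
rewrite -Lminus_Rminus // -Lplus_Rplus // -L0_R // -Lz_Rz.
rewrite -!actM !pushE.
by lin_comb R[i]; field; rewrite ?q0 ?q1 ?t0.
Qed.

Lemma wedge_basis0 (w : 4.-tuple O) : wedge_basis w set0 = 1.
Proof. by rewrite /wedge_basis big_pred0 // => i; rewrite inE. Qed.

Lemma wedge_basis1 (w : 4.-tuple O) i : wedge_basis w [set i] = tnth w i.
Proof. by rewrite /wedge_basis (big_pred1 i) // => j; rewrite inE. Qed.

Lemma wedge_basisT : wedge_basis [tuple wm; wp; w0; wz] setT = wm * wp * w0 * wz.
Proof.
rewrite /wedge_basis big_mkcond !big_ord_recl big_ord0 !inE !(tnth_nth 0) /=.
by rewrite mulr1 !mulrA.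
Qed.

Lemma form_of_degree_basis (w : 4.-tuple O) x (I : {set 'I_4}) :
  form_of_degree (inc O) w #|I| (inc O x * wedge_basis w I).
Proof.
exists [ffun J => if J == I then x else 0].
rewrite (bigD1 I) //= ffunE eqxx big1 ?addr0 // => J /andP[_ /negPf JI].
by rewrite ffunE JI rmorph0 mul0r.
Qed.

Lemma left_invariant_basis I : left_invariant (wedge_basis [tuple wm; wp; w0; wz] I).
Proof.
rewrite /left_invariant; move: [tuple _; _; _; _] => w.
exists [ffun J => (J == I)%:R].
rewrite (bigD1 I) //= ffunE eqxx scale1r big1 ?addr0 // => J /negPf JI.
by rewrite ffunE JI scale0r.
Qed.

Lemma left_invariantZ k (eta : O) : left_invariant eta -> left_invariant (k *: eta).
Proof.
move=> [c ->]; exists [ffun J => k * c J]; rewrite scaler_sumr.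
by apply: eq_bigr => J _; rewrite ffunE scalerA.
Qed.

Lemma form0 x : form_of_degree (inc O) [tuple wm; wp; w0; wz] 0 (inc O x).
Proof.
by have := form_of_degree_basis [tuple wm; wp; w0; wz] x set0;
  rewrite cards0 wedge_basis0 mulr1.
Qed.

Lemma form1 i : form_of_degree (inc O) [tuple wm; wp; w0; wz] 1 (tnth [tuple wm; wp; w0; wz] i).
Proof.
by have := form_of_degree_basis [tuple wm; wp; w0; wz] 1 [set i];
  rewrite cards1 wedge_basis1 rmorph1 mul1r.
Qed.

(** [d] acts on [eta] as on a form of odd degree, by anticommutation with [theta]. *)
Definition d_odd (eta : O) := d O eta = theta * eta + eta * theta.

Lemma d_oddD eta zeta : d_odd eta -> d_odd zeta -> d_odd (eta + zeta).
Proof. by rewrite /d_odd linearD => -> ->; rewrite mulrDr mulrDl addrACA. Qed.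

Lemma d_oddZ k eta : d_odd eta -> d_odd (k *: eta).
Proof.
by rewrite /d_odd => d_eta; rewrite linearZ /= d_eta scalerDr [k *: (theta * _)]scalerAr scalerAl.
Qed.

(** On both sides the terms containing [theta theta] vanish, and the remaining ones
agree: this is the Leibniz rule for a graded commutator. *)
Lemma d_odd_inc x y : d_odd (inc O x * d O (inc O y)).
Proof.
rewrite /d_odd (d_leibniz _ (form0 x)) d_d mulr0 scaler0 addr0.
have thetaA (eta : O) : theta * (theta * eta) = 0 by rewrite mulrA theta_theta ?mul0r.
rewrite !d_inc !(mulrDl, mulrDr, mulNr, mulrN) -!mulrA thetaA theta_theta //.
rewrite !mulr0; lin_comb R[i]; ring.
Qed.

(** The eigenvalue of [L0], a shifted Casimir element, on the span of the generators
of the algebra and their adjoints, where [U] acts by spin one half. *)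
Definition kap0 : R := (q ^+ 2 + q ^- 2 - q - q^-1) / lam ^+ 2.

Lemma act_K x k : k != 0 -> ac K x = k *: x -> ac Ki x = k^-1 *: x.
Proof.
move=> k0 Kx; have : ac (Ki * K) x = x by rewrite (uq_KiK (uq_rel U)) act1.
by rewrite actM Kx actZr => {2}<-; rewrite scalerA mulVf // scale1r.
Qed.

Lemma sqr_sqrtC : t%:C * t%:C = q%:C :> R[i].
Proof. by rewrite -rmorphM -expr2 sqr_sqrtr // ltW. Qed.

Lemma sqr_sqrtCV : (t^-1)%:C * (t^-1)%:C = (q^-1)%:C :> R[i].
Proof. by rewrite -rmorphM -invfM -expr2 sqr_sqrtr // ltW. Qed.

(** The differential of the two weight vectors of a spin one half representation;
the generators [a], [c] are lowest weight vectors, their adjoints highest ones. *)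
Lemma d_lowest x : ac K x = (t^-1)%:C *: x -> ac F x = 0 -> ac F (ac E x) = x ->
  d O (inc O x) = inc O (ac E x) * wp + kap0%:C *: (inc O x * w0)
   + ((q - 1) / lam)%:C *: (inc O x * wz).
Proof.
move=> Kx Fx FEx.
have Kix : ac Ki x = t%:C *: x by rewrite (act_K _ Kx) fmorphV ?invrK // invr_eq0.
have K2x : ac (K ^+ 2) x = (q^-1)%:C *: x.
  by rewrite expr2 actM Kx actZr Kx scalerA sqr_sqrtCV.
have Ki2x : ac (Ki ^+ 2) x = q%:C *: x by rewrite expr2 actM Kix actZr Kix scalerA sqr_sqrtC.
rewrite d_fun /Lminus /Lplus /L0 /Lz.
rewrite !(pushE, K2x, Ki2x, actM, Kix, actZr, Fx, FEx, scaler0, rmorph0, mul0r).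
by lin_comb R[i]; rewrite /kap0; field; rewrite ?q0 ?q1 ?t0.
Qed.

Lemma d_highest x : ac K x = t%:C *: x -> ac E x = 0 ->
  d O (inc O x) = inc O (ac F x) * wm + kap0%:C *: (inc O x * w0)
   + ((q^-1 - 1) / lam)%:C *: (inc O x * wz).
Proof.
move=> Kx Ex.
have Kix : ac Ki x = (t^-1)%:C *: x by rewrite (act_K _ Kx) ?fmorphV.
have K2x : ac (K ^+ 2) x = q%:C *: x by rewrite expr2 actM Kx actZr Kx scalerA sqr_sqrtC.
have Ki2x : ac (Ki ^+ 2) x = (q^-1)%:C *: x.
  by rewrite expr2 actM Kix actZr Kix scalerA sqr_sqrtCV.
rewrite d_fun /Lminus /Lplus /L0 /Lz.
rewrite !(pushE, K2x, Ki2x, actM, Kix, actZr, act0r, Ex, scaler0, rmorph0, mul0r).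
by lin_comb R[i]; rewrite /kap0; field; rewrite ?q0 ?q1 ?t0.
Qed.

Local Notation a := (gen_a A).
Local Notation c := (gen_c A).
Local Notation ad := (suq2_star (gen_a A)).
Local Notation cd := (suq2_star (gen_c A)).
Local Notation st := (@suq2_star R q A).

Lemma d_a : d O (inc O a) = - (q%:C *: (inc O cd * wp)) + kap0%:C *: (inc O a * w0)
   + ((q - 1) / lam)%:C *: (inc O a * wz).
Proof.
rewrite d_lowest ?actK_a ?actF_a ?actE_a ?incN ?incZ ?mulNr ?algZl //.
by rewrite actNr actZr actF_cs scalerN opprK scalerA -rmorphM mulfV ?scale1r ?gt_eqF.
Qed.

Lemma d_c : d O (inc O c) = inc O ad * wp + kap0%:C *: (inc O c * w0)
   + ((q - 1) / lam)%:C *: (inc O c * wz).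
Proof. by rewrite d_lowest ?actK_c ?actF_c ?actE_c ?actF_as. Qed.

Lemma d_as : d O (inc O ad) = inc O c * wm + kap0%:C *: (inc O ad * w0)
   + ((q^-1 - 1) / lam)%:C *: (inc O ad * wz).
Proof. by rewrite d_highest ?actK_as ?actE_as ?actF_as. Qed.

Lemma d_cs : d O (inc O cd) = - ((q^-1)%:C *: (inc O a * wm)) + kap0%:C *: (inc O cd * w0)
   + ((q^-1 - 1) / lam)%:C *: (inc O cd * wz).
Proof. by rewrite d_highest ?actK_cs ?actE_cs ?actF_cs // incN incZ mulNr algZl. Qed.

Lemma star_gen : cd * ad = q%:C *: (ad * cd).
Proof.
have stP := suq2_starP A; have rel := suq2_rel A.
have st0 : st 0 = 0.
  apply: (@addrI _ (st 0)); rewrite addr0 -{1}(scale1r (st 0)).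
  by have := star_antilinear stP 1 0 0; rewrite scale1r addr0 conjc1.
rewrite -!(star_antimultiplicative stP) (suq2_ac rel) -[_ *: _]addr0.
by rewrite (star_antilinear stP) st0 addr0 conjc_real.
Qed.

Local Notation A_ := (inc O a).
Local Notation C_ := (inc O c).
Local Notation As_ := (inc O ad).
Local Notation Cs_ := (inc O cd).

(** In these four formulas the determinant relations produce the coefficient of the
surviving generators, and the commutation relations annihilate the others. *)
Lemma wp_exact : wp = A_ * d O C_ - q%:C *: (C_ * d O A_).
Proof.
have rel := suq2_rel A.
have e1 : A_ * C_ = q%:C *: (C_ * A_) by rewrite -!incM (suq2_ac rel) incZ.
have e2 : A_ * As_ = 1 - (q ^+ 2)%:C *: (C_ * Cs_).
  by rewrite -!incM -incZ -inc1 -(suq2_det' rel) incD addrK.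
rewrite d_a d_c !pushE !mulrA e1 e2 !pushE !mul1r.
by lin_comb R[i]; field; rewrite ?q0 ?q1 ?t0.
Qed.

Lemma wm_exact : wm = Cs_ * d O As_ - q%:C *: (As_ * d O Cs_).
Proof.
have rel := suq2_rel A.
have e1 : Cs_ * As_ = q%:C *: (As_ * Cs_) by rewrite -!incM star_gen incZ.
have e2 : As_ * A_ = 1 - Cs_ * C_.
  by rewrite -!incM -inc1 -(suq2_det rel) incD addrK.
rewrite d_as d_cs !pushE !mulrA e1 e2 !pushE !mul1r.
by lin_comb R[i]; field; rewrite ?q0 ?q1 ?t0.
Qed.

Lemma wz_w0_exact1 :
  As_ * d O A_ + Cs_ * d O C_ = kap0%:C *: w0 + ((q - 1) / lam)%:C *: wz.
Proof.
have rel := suq2_rel A.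
have e1 : Cs_ * As_ = q%:C *: (As_ * Cs_) by rewrite -!incM star_gen incZ.
have e2 : As_ * A_ = 1 - Cs_ * C_.
  by rewrite -!incM -inc1 -(suq2_det rel) incD addrK.
rewrite d_a d_c !pushE !mulrA e1 e2 !pushE !mul1r.
by lin_comb R[i]; field; rewrite ?q0 ?q1 ?t0.
Qed.

Lemma wz_w0_exact2 :
  A_ * d O As_ + (q ^+ 2)%:C *: (C_ * d O Cs_) = kap0%:C *: w0 + ((q^-1 - 1) / lam)%:C *: wz.
Proof.
have rel := suq2_rel A.
have e1 : A_ * C_ = q%:C *: (C_ * A_) by rewrite -!incM (suq2_ac rel) incZ.
have e2 : A_ * As_ = 1 - (q ^+ 2)%:C *: (C_ * Cs_).
  by rewrite -!incM -incZ -inc1 -(suq2_det' rel) incD addrK.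
rewrite d_as d_cs !pushE !mulrA e1 e2 !pushE !mul1r.
by lin_comb R[i]; field; rewrite ?q0 ?q1 ?t0.
Qed.

Lemma d_odd_wp : d_odd wp.
Proof. by rewrite wp_exact -scaleNr; apply/d_oddD/d_oddZ/d_odd_inc/d_odd_inc. Qed.

Lemma d_odd_wm : d_odd wm.
Proof. by rewrite wm_exact -scaleNr; apply/d_oddD/d_oddZ/d_odd_inc/d_odd_inc. Qed.

Lemma d_odd_wz : d_odd wz.
Proof.
have -> : wz = As_ * d O A_ + Cs_ * d O C_
             + (-1) *: (A_ * d O As_ + (q ^+ 2)%:C *: (C_ * d O Cs_)).
  rewrite wz_w0_exact1 wz_w0_exact2.
  by lin_comb R[i]; field; rewrite ?q0 ?q1.
by apply/d_oddD/d_oddZ/d_oddD/d_oddZ/d_odd_inc/d_odd_inc; apply/d_oddD/d_odd_inc/d_odd_inc.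
Qed.

(** The formula for [w0] requires [kap0] to be nonzero, which holds since its numerator
is [(1 - q)^2 (q^2 + q + 1) / q^2]. *)
Lemma d_odd_w0 : d_odd w0.
Proof.
have kap0_neq0 : kap0%:C != 0 :> R[i].
  rewrite fmorph_eq0 /kap0 mulf_neq0 ?invr_eq0 ?expf_neq0 //; last first.
    by rewrite subr_eq0 lt_eqF // (lt_trans q_lt1) // invf_gt1.
  have -> : q ^+ 2 + q ^- 2 - q - q^-1 = (1 - q) ^+ 2 * (q ^+ 2 + q + 1) / q ^+ 2.
    by field; rewrite gt_eqF.
  by rewrite gt_eqF // divr_gt0 ?mulr_gt0 ?exprn_gt0 ?subr_gt0 // !addr_gt0 ?exprn_gt0.
have -> : w0 = kap0%:C^-1 *: (As_ * d O A_ + Cs_ * d O C_ + (- ((q - 1) / lam)%:C) *: wz).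
  by rewrite wz_w0_exact1 scaleNr addrK scalerA mulVf ?scale1r.
by apply/d_oddZ/d_oddD/d_oddZ/d_odd_wz/d_oddD/d_odd_inc/d_odd_inc.
Qed.

Lemma d_odd_gen i : d_odd (tnth [tuple wm; wp; w0; wz] i).
Proof.
case: i => [[|[|[|[|//]]]] i_lt]; rewrite (tnth_nth 0) /=;
  [exact: d_odd_wm | exact: d_odd_wp | exact: d_odd_w0 | exact: d_odd_wz].
Qed.

Lemma d_gen_mul i zeta : let w := tnth [tuple wm; wp; w0; wz] i in
  d O (w * zeta) = (theta * w + w * theta) * zeta - w * d O zeta.
Proof. by rewrite /= (d_leibniz _ (form1 i)) -d_odd_gen scaleN1r. Qed.

Lemma d_three_mul i j k zeta : let w := tnth [tuple wm; wp; w0; wz] in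
  let eta := w i * w j * w k in
  d O (eta * zeta) = (theta * eta + eta * theta) * zeta - eta * d O zeta.
Proof.
move: (d_gen_mul i) (d_gen_mul j) (d_gen_mul k) => /=.
move: (tnth _ i) (tnth _ j) (tnth _ k) => wi wj wk di dj dk.
rewrite -!mulrA di dj dk !(mulrDl, mulrDr, mulNr, mulrN) -!mulrA.
by lin_comb R[i]; ring.
Qed.

Lemma theta_three :
  [/\ theta * (wm * w0 * wz) + wm * w0 * wz * theta = 0,
    theta * (wp * w0 * wz) + wp * w0 * wz * theta = 0,
    theta * (wm * wp * w0) + wm * wp * w0 * theta = 0 &
    theta * (wm * wp * wz) + wm * wp * wz * theta = 0].
Proof.
split; rewrite /theta !(mulrDl, mulrDr, algZl, algZr).
- by rewrite !wedge_left_m ?wedge_right_m //; lin_comb R[i]; ring.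
- by rewrite !wedge_left_p ?wedge_right_p //; lin_comb R[i]; ring.
- by rewrite !wedge_left_0 ?wedge_right_0 //; lin_comb R[i]; ring.
- by rewrite !wedge_left_z ?wedge_right_z //; lin_comb R[i]; ring.
Qed.

(** With [d eta = theta eta + eta theta = 0], only the derivative of the coefficient
is left. *)
Lemma d_three_inc i j k y : let w := tnth [tuple wm; wp; w0; wz] in
  let eta := w i * w j * w k in theta * eta + eta * theta = 0 ->
  d O (inc O y * eta) = d O (inc O y) * eta /\
  d O (eta * inc O y) = - (eta * d O (inc O y)).
Proof.
move=> w eta eta0.
have d_eta_mul zeta : d O (eta * zeta) = - (eta * d O zeta).
  by rewrite d_three_mul -/w -/eta eta0 mul0r add0r.
split; last exact: d_eta_mul.
have d1 : d O (1 : O) = 0 by rewrite -inc1 d_inc inc1 mulr1 mul1r subrr.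
have d_eta : d O eta = 0 by rewrite -[eta]mulr1 d_eta_mul d1 mulr0 oppr0.
by rewrite (d_leibniz _ (form0 y)) d_eta mulr0 scaler0 addr0.
Qed.

Lemma d_closed_inc y :
  ((d O (inc O y * (wm * w0 * wz)) = d O (inc O y) * (wm * w0 * wz))%R
  * (d O (inc O y * (wp * w0 * wz)) = d O (inc O y) * (wp * w0 * wz))%R
  * (d O (inc O y * (wm * wp * w0)) = d O (inc O y) * (wm * wp * w0))%R
  * (d O (inc O y * (wm * wp * wz)) = d O (inc O y) * (wm * wp * wz))%R
  * (d O (wm * w0 * wz * inc O y) = - (wm * w0 * wz * d O (inc O y)))%R
  * (d O (wp * w0 * wz * inc O y) = - (wp * w0 * wz * d O (inc O y)))%R
  * (d O (wm * wp * w0 * inc O y) = - (wm * wp * w0 * d O (inc O y)))%R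
  * (d O (wm * wp * wz * inc O y) = - (wm * wp * wz * d O (inc O y)))%R)%type.
Proof.
have [cm cp c0 cz] := theta_three.
pose i0 : 'I_4 := @Ordinal 4 0 isT; pose i1 : 'I_4 := @Ordinal 4 1 isT.
pose i2 : 'I_4 := @Ordinal 4 2 isT; pose i3 : 'I_4 := @Ordinal 4 3 isT.
have [lm rm] := @d_three_inc i0 i2 i3 y cm.
have [lp rp] := @d_three_inc i1 i2 i3 y cp.
have [l0 r0] := @d_three_inc i0 i1 i2 y c0.
have [lz rz] := @d_three_inc i0 i1 i3 y cz.
by do !split.
Qed.

End Differential.

(** * The two Laplacians *)

Section Hodge.
Variables (R : realType) (q : R).
Hypotheses (q_gt0 : 0 < q) (q_lt1 : q < 1).
Let q0 := qC_neq0 q_gt0.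
Variables (A : suq2 q) (U : uqsu2 q) (ac : suq2_action A U) (O : calculus4Dp ac).
Variables (alpha nu gamma epsilon m : R) (star starL starR : O -> O).
Hypotheses (hstar : hodge alpha nu gamma epsilon m star)
    (hstarL : left_hodge star starL) (hstarR : right_hodge star starR).

Local Notation wm := (wm O).
Local Notation wp := (wp O).
Local Notation w0 := (w0 O).
Local Notation wz := (wz O).

Lemma left_invariant_gen i : left_invariant (tnth [tuple wm; wp; w0; wz] i).
Proof. by rewrite -wedge_basis1; apply: left_invariant_basis. Qed.

Lemma left_invariant_gens :
  [/\ left_invariant wm, left_invariant wp, left_invariant w0 & left_invariant wz].
Proof.
by split; [have := left_invariant_gen (inord 0) | have := left_invariant_gen (inord 1)
  | have := left_invariant_gen (inord 2) | have := left_invariant_gen (inord 3)];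
  rewrite (tnth_nth 0) inordK.
Qed.

Lemma left_invariant_volume : left_invariant (volume O m).
Proof. by rewrite /volume -wedge_basisT; apply/left_invariantZ/left_invariant_basis. Qed.

Lemma dD (eta zeta : O) : d O (eta + zeta) = d O eta + d O zeta.
Proof. exact: linearD. Qed.

Lemma dN (eta : O) : d O (- eta) = - d O eta.
Proof. exact: linearN. Qed.

Lemma dZ k (eta : O) : d O (k *: eta) = k *: d O eta.
Proof. exact: linearZ. Qed.

Lemma laplacianL x : laplacian starL x =
     inc O (ac (alpha%:C *: (Lplus U * Lminus U
                             + (q ^+ 2)%:C *: (Lminus U * Lplus U))
                + nu%:C *: (L0 U * L0 U)
                + gamma%:C *: (Lz U * Lz U)
                + (2 * epsilon)%:C *: (L0 U * Lz U)) x).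
Proof.
have [im ip i0 iz] := left_invariant_gens.
(* The operators are made opaque, so that rewriting does not expand them. *)
have comm := comm_L0_Lz q_gt0 U.
have dE := d_fun O; rewrite /laplacian.
move: (Lminus U) (Lplus U) (L0 U) (Lz U) comm dE => Lm Lp L0 Lz comm dE.
set Z := ac _ x.
(* The star of the volume form is 1, so it suffices to find the 4-form. *)
suff dstar : d O (starL (d O (inc O x))) = inc O (- Z) * volume O m.
  rewrite dstar (starL_left hstarL) ?(hodge_volume hstar);
    last exact: left_invariant_volume.
  by rewrite mulr1 incN opprK.
rewrite dE !(starL_additive hstarL) !(starL_left hstarL) //.
rewrite (hodge_m hstar) (hodge_p hstar) (hodge_0 hstar) (hodge_z hstar).
rewrite !pushE !(dD, dN, dZ) !d_closed_inc // !dE !mulrDl -![inc O _ * _ * _]mulrA.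
rewrite !wedge_left_m // !wedge_left_p // !wedge_left_0 // !wedge_left_z //.
rewrite /Z /volume -!actM !pushE ?mulr0 -comm.
move: (wm * wp * w0 * wz) => vol.
by lin_comb R[i]; ring.
Qed.

(** Here [d] passes over a three-form, and the sign cancels the one in front of the
Laplacian. *)
Lemma laplacianR x : laplacian starR x =
     inc O (ac (alpha%:C *: ((q ^+ 2)%:C *: (Rplus U * Rminus U)
                             + Rminus U * Rplus U)
                + nu%:C *: (R0 U * R0 U)
                + gamma%:C *: (Rz U * Rz U)
                + (2 * epsilon)%:C *: (R0 U * Rz U)) x).
Proof.
have [im ip i0 iz] := left_invariant_gens.
have comm := comm_R0_Rz q_gt0 U.
have dE := d_inc_right q_gt0 q_lt1 O; rewrite /laplacian.
move: (Rminus U) (Rplus U) (R0 U) (Rz U) comm dE => Rm Rp R0 Rz comm dE.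
set Z := ac _ x.
suff dstar : d O (starR (d O (inc O x))) = volume O m * inc O (- Z).
  rewrite dstar (starR_right hstarR) ?(hodge_volume hstar);
    last exact: left_invariant_volume.
  by rewrite mul1r incN opprK.
rewrite dE !(starR_additive hstarR) !(starR_right hstarR) //.
rewrite (hodge_m hstar) (hodge_p hstar) (hodge_0 hstar) (hodge_z hstar).
rewrite !pushE !(dD, dN, dZ) !d_closed_inc // !dE !mulrDr ![_ * (_ * inc O _)]mulrA.
rewrite !wedge_right_m // !wedge_right_p // !wedge_right_0 // !wedge_right_z //.
rewrite /Z /volume -!actM !pushE ?mul0r -comm.
move: (wm * wp * w0 * wz) => vol.
by lin_comb R[i]; field; rewrite ?q0.
Qed.

End Hodge.

Theorem mainTheorem2 (R : realType) (q : R) (hq0 : 0 < q) (hq1 : q < 1)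
    (A : suq2 q) (U : uqsu2 q) (ac : suq2_action A U) (O : calculus4Dp ac)
    (alpha nu gamma epsilon : R) (G : O -> O -> R[i])
    (hG : hermitian_real_contraction G alpha nu gamma epsilon)
    (hnondeg : alpha != 0)
    (m : R) (star starL starR : O -> O)
    (hstar : hodge alpha nu gamma epsilon m star)
    (hstarL : left_hodge star starL) (hstarR : right_hodge star starR) :
  (forall x : A,
     laplacian starL x =
     inc O (ac (alpha%:C *: (Lplus U * Lminus U
                             + (q ^+ 2)%:C *: (Lminus U * Lplus U))
                + nu%:C *: (L0 U * L0 U)
                + gamma%:C *: (Lz U * Lz U)
                + (2 * epsilon)%:C *: (L0 U * Lz U)) x)) /\
  (forall x : A,
     laplacian starR x =
     inc O (ac (alpha%:C *: ((q ^+ 2)%:C *: (Rplus U * Rminus U)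
                             + Rminus U * Rplus U)
                + nu%:C *: (R0 U * R0 U)
                + gamma%:C *: (Rz U * Rz U)
                + (2 * epsilon)%:C *: (R0 U * Rz U)) x)).
Proof.
split=> x; first exact: (laplacianL hq0 hq1 hstar hstarL).
exact: (laplacianR hq0 hq1 hstar hstarR).
Qed.
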